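(* Let $(E,\pi)$ be a Jordan Banach triple system. Then for every $m,n,p\in E^{**}$, $$\pi^0(m,n,p)=\pi^2(p,n,m),\qquad \pi^1(m,n,p)=\pi^4(p,n,m),\qquad \pi^3(m,n,p)=\pi^5(p,n,m).$$ Furthermore, if $\pi^0$ is symmetric in the outer variables (i.e. $\pi^0(m,n,p)=\pi^0(p,n,m)$ for all $m,n,p\in E^{**}$), then $\pi^0=\pi^1=\pi^2=\pi^4$.
   Context: Jordan Banach triple systems are taken complex: a complex Banach space $E$ with a jointly continuous map $\pi=\{\cdot,\cdot,\cdot\}:E\times E\times E\to E$ which is bilinear and symmetric in the outer variables, conjugate linear in the middle one, and satisfies the Jordan identity $\{a,b,\{c,d,e\}\}=\{\{a,b,c\},d,e\}-\{c,\{b,a,d\},e\}+\{c,d,\{a,b,e\}\}$ for all $a,b,c,d,e\in E$. The six Aron--Berner extensions $\pi^0,\dots,\pi^5:E^{**}\times E^{**}\times E^{**}\to E^{**}$ of $\pi$ (bilinear in the outer variables, conjugate linear in the middle one) are given by iterated $w^*$-limits: for $m,n,p\in E^{**}$ and bounded nets $(m_{\alpha_1}),(n_{\alpha_2}),(p_{\alpha_3})$ in $E$ converging in the $w^*$-topology to $m,n,p$ respectively, $\pi^i(m,n,p)=w^*\text{-}\lim_{\alpha_{\sigma_i(1)}}\lim_{\alpha_{\sigma_i(2)}}\lim_{\alpha_{\sigma_i(3)}}\pi(m_{\alpha_1},n_{\alpha_2},p_{\alpha_3})$ (all limits in the $w^*$-topology, the rightmost limit taken first; the result does not depend on the nets),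 where $(\sigma_i(1),\sigma_i(2),\sigma_i(3))$ is $(1,2,3)$ for $i=0$, $(1,3,2)$ for $i=1$, $(3,2,1)$ for $i=2$, $(2,1,3)$ for $i=3$, $(3,1,2)$ for $i=4$, $(2,3,1)$ for $i=5$. *)

(* Defs.v *)
From HB Require Import structures.
From mathcomp Require Import all_boot all_order all_algebra.
From mathcomp Require Import complex.
From mathcomp Require Import all_classical all_reals all_analysis.

Set Implicit Arguments.
Unset Strict Implicit.
Unset Printing Implicit Defensive.

Import Order.TTheory GRing.Theory Num.Theory.
Import numFieldNormedType.Exports.
Local Open Scope classical_set_scope.
Local Open Scope ring_scope.

Section Dual.
Variables (R : realType) (E : normedModType R[i]).
Local Notation C := (R[i]^o).

Definition dual_pred : {pred E -> C} :=
  fun f => `[< linear f /\ continuous f >].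

Record dual := Dual { dual_fun :> E -> C; dualP : dual_fun \in dual_pred }.

HB.instance Definition _ := [isSub for dual_fun].
HB.instance Definition _ := [Choice of dual by <:].

Lemma dual_linear (f : dual) : linear f.
Proof. by case: f => f /= /asboolP[]. Qed.

Lemma dual_continuous (f : dual) : continuous f.
Proof. by case: f => f /= /asboolP[]. Qed.

HB.instance Definition _ (f : dual) :=
  GRing.isLinear.Build R[i] E C *:%R f (@dual_linear f).

Lemma dual_submod_closed : submod_closed dual_pred.
Proof.
split.
  apply/asboolP; split; last exact: cst_continuous.
  by move=> k x y /=; rewrite scaler0 addr0.
move=> k f g /asboolP[lf cf] /asboolP[lg cg]; apply/asboolP; split.
  move=> c x y.
  have lE (h : E -> C) z : (k *: h) z = k *: h z by [].
  have aE (h1 h2 : E -> C) z : (h1 + h2) z = h1 z + h2 z by [].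
  rewrite !aE !lE lf lg !scalerDr !scalerA [k * c]mulrC !addrA.
  by congr (_ + _); rewrite addrAC.
by move=> x; apply: cvgD; [apply: cvgZl_tmp; exact: cf | exact: cg].
Qed.

HB.instance Definition _ :=
  GRing.isSubmodClosed.Build R[i] (E -> C) dual_pred dual_submod_closed.
HB.instance Definition _ := [SubChoice_isSubLmodule of dual by <:].


Definition dual_norm (f : dual) : R[i] :=
  (sup [set complex.Re `|f x| | x in [set x : E | `|x| <= 1]])%:C%C.

Lemma ReK_ge0 (z : R[i]) : 0 <= z -> (complex.Re z)%:C%C = z.
Proof. by move=> z0; apply: RRe_real; exact: ger0_real. Qed.

Lemma le_Re (y z : R[i]) : y <= z -> complex.Re y <= complex.Re z.
Proof. by rewrite lecE => /andP[]. Qed.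

Lemma has_sup_dual_norm (f : dual) :
  has_sup [set complex.Re `|f x| | x in [set x : E | `|x| <= 1]].
Proof.
split; first by exists (complex.Re `|f 0|), 0 => //=; rewrite normr0.
have /linear_bounded_continuous/bounded_funP/(_ 1)[M fM] :=
  @dual_continuous f.
by exists (complex.Re M) => _ [x /= x1 <-]; exact: le_Re (fM _ x1).
Qed.

Lemma dual_norm_ge0 (f : dual) : 0 <= dual_norm f.
Proof.
rewrite /dual_norm -[0]/(0%:C%C) lecR.
apply: le_trans (ub_le_sup (has_sup_dual_norm f).2 _); last first.
  by exists 0 => //=; rewrite normr0.
by have := le_Re (normr_ge0 (f 0)).
Qed.

Lemma dual_normP (f : dual) (x : E) : `|f x| <= dual_norm f * `|x|.
Proof.
have [->|x0] := eqVneq x 0; first by rewrite linear0 !normr0 mulr0.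
rewrite -ler_pdivrMr ?normr_gt0//.
have -> : `|f x| / `|x| = `|f (`|x|^-1 *: x)|.
  by rewrite linearZ/= normrZ normfV normr_id mulrC.
rewrite -[leLHS]ReK_ge0// lecR.
apply: (ub_le_sup (has_sup_dual_norm f).2); exists (`|x|^-1 *: x) => //=.
by rewrite normrZ normfV normr_id mulVf ?normr_eq0.
Qed.

Lemma dual_norm_le (f : dual) (M : R[i]) :
  (forall x : E, `|x| <= 1 -> `|f x| <= M) -> dual_norm f <= M.
Proof.
move=> fM.
have M0 : 0 <= M by apply: le_trans (fM 0 _); rewrite ?normr0.
rewrite -(ReK_ge0 M0) lecR; apply: ge_sup; first exact: (has_sup_dual_norm f).1.
by move=> _ [x x1 <-]; exact: le_Re (fM _ x1).
Qed.

Lemma dual_normD (f g : dual) : dual_norm (f + g) <= dual_norm f + dual_norm g.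
Proof.
apply: dual_norm_le => x x1; apply: le_trans (ler_normD _ _) _.
by apply: lerD; apply: le_trans (dual_normP _ _) _;
  apply: ler_piMr => //; exact: dual_norm_ge0.
Qed.

Lemma dual_normZ (k : R[i]) (f : dual) :
  dual_norm (k *: f) = `|k| * dual_norm f.
Proof.
have le_Z (l : R[i]) (g : dual) : dual_norm (l *: g) <= `|l| * dual_norm g.
  apply: dual_norm_le => x x1.
  rewrite -[(l *: g) x]/(l * g x) normrM ler_wpM2l//.
  by apply: le_trans (dual_normP _ _) _; apply: ler_piMr; last exact: x1;
    exact: dual_norm_ge0.
apply/eqP; rewrite eq_le le_Z/=.
have [->|k0] := eqVneq k 0; first by rewrite normr0 mul0r dual_norm_ge0.
rewrite -ler_pdivlMl ?normr_gt0// -normfV.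
by apply: le_trans (le_Z _ _); rewrite scalerA mulVf// scale1r.
Qed.

Lemma dual_norm0_eq0 (f : dual) : dual_norm f = 0 -> f = 0.
Proof.
move=> f0; apply/val_inj/funext => x /=; apply/normr0_eq0/eqP.
by rewrite eq_le normr_ge0 andbT -[leRHS](mul0r `|x|) -f0 dual_normP.
Qed.

HB.instance Definition _ := @Lmodule_isNormed.Build R[i] dual
  dual_norm dual_normD dual_normZ dual_norm0_eq0.

End Dual.

Notation bidual E := (dual (dual E)).

Section Bidual.
Variables (R : realType) (E : normedModType R[i]).

Definition eval_at (x : E) (f : dual E) : R[i]^o := f x.

Lemma eval_at_dual (x : E) : eval_at x \in @dual_pred R (dual E).
Proof.
apply/asboolP.
have lx : linear (eval_at x) by move=> k f g.
split=> //.
pose h : {linear dual E -> R[i]^o} :=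
  HB.pack (eval_at x) (GRing.isLinear.Build _ _ _ _ _ lx).
apply: (@bounded_linear_continuous _ _ _ h); apply/bounded_funP => r.
exists (r * `|x|) => f fr.
by apply: le_trans (dual_normP f x) _; rewrite ler_wpM2r.
Qed.

Definition bidual_embed (x : E) : bidual E := Dual (eval_at_dual x).

End Bidual.

Record net (T : Type) := Net {
  net_index : Type;
  net_le : net_index -> net_index -> Prop;
  net_refl : forall a, net_le a a;
  net_trans : forall a b c, net_le a b -> net_le b c -> net_le a c;
  net_directed : forall a b, exists c, net_le a c /\ net_le b c;
  net_inhabited : exists a : net_index, True;
  net_fun :> net_index -> T }.

(* the filter of eventual sets of the index set of u *)
Definition net_tails (T : Type) (u : net T) : set_system (net_index u) :=
  [set A | exists a0, forall a, net_le a0 a -> A a].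
Arguments net_tails {T} u.

Definition bounded_net (R : realType) (E : normedModType R[i]) (u : net E) :=
  exists M : R[i], forall a, `|u a| <= M.

Section AronBerner.
Variables (R : realType) (E : normedModType R[i]).

(* The w*-topology of E** is that of pointwise convergence on E*. *)
Definition wstar_cvg (I : Type) (F : set_system I) (g : I -> bidual E)
    (m : bidual E) : Prop :=
  {ptws, (fun a => g a : dual E -> R[i]^o) @ F --> (m : dual E -> R[i]^o)}.

(* w*-lim_a lim_b lim_c (g a b c) = q, the innermost limit (in c) being taken
   first; the inner limits h2 and h1 are required to exist in E**. *)
Definition iterated_wstar_lim (T : Type) (u v w : net T)
    (g : net_index u -> net_index v -> net_index w -> bidual E)
    (q : bidual E) : Prop :=
  exists (h2 : net_index u -> net_index v -> bidual E)
         (h1 : net_index u -> bidual E),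
    [/\ forall a b, wstar_cvg (net_tails w) (g a b) (h2 a b),
        forall a, wstar_cvg (net_tails v) (h2 a) (h1 a)
      & wstar_cvg (net_tails u) h1 q].

(* The value at (m, n, p) of the extension with order of limits L: the element
   of E** that is the iterated limit L along all bounded nets in E converging
   to m, n, p in the w*-topology. It exists and, such nets existing by
   Goldstine's theorem, it is unique, so the default value 0 is never used. *)
Definition wstar_extension
    (L : net E -> net E -> net E -> bidual E -> Prop) (m n p : bidual E) :
    bidual E :=
  xget 0 [set q | forall u v w : net E,
    bounded_net u -> bounded_net v -> bounded_net w ->
    wstar_cvg (net_tails u) (@bidual_embed R E \o u) m ->
    wstar_cvg (net_tails v) (@bidual_embed R E \o v) n ->
    wstar_cvg (net_tails w) (@bidual_embed R E \o w) p ->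
    L u v w q].

Variable pi : E -> E -> E -> E.

Definition aron_berner0 := wstar_extension (fun u v w =>
  iterated_wstar_lim (u := u) (v := v) (w := w)
    (fun a b c => bidual_embed (pi (u a) (v b) (w c)))).

Definition aron_berner1 := wstar_extension (fun u v w =>
  iterated_wstar_lim (u := u) (v := w) (w := v)
    (fun a c b => bidual_embed (pi (u a) (v b) (w c)))).

Definition aron_berner2 := wstar_extension (fun u v w =>
  iterated_wstar_lim (u := w) (v := v) (w := u)
    (fun c b a => bidual_embed (pi (u a) (v b) (w c)))).

Definition aron_berner3 := wstar_extension (fun u v w =>
  iterated_wstar_lim (u := v) (v := u) (w := w)
    (fun b a c => bidual_embed (pi (u a) (v b) (w c)))).

Definition aron_berner4 := wstar_extension (fun u v w =>
  iterated_wstar_lim (u := w) (v := u) (w := v)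
    (fun c a b => bidual_embed (pi (u a) (v b) (w c)))).

Definition aron_berner5 := wstar_extension (fun u v w =>
  iterated_wstar_lim (u := v) (v := w) (w := u)
    (fun b c a => bidual_embed (pi (u a) (v b) (w c)))).

End AronBerner.

Record jordan_banach_triple (R : realType) (E : completeNormedModType R[i])
    (pi : E -> E -> E -> E) : Prop := JordanBanachTriple {
  jbt_continuous : continuous (fun x : E * E * E => pi x.1.1 x.1.2 x.2);
  jbt_linear_l : forall b c, linear (fun a => pi a b c);
  jbt_linear_r : forall a b, linear (fun c => pi a b c);
  jbt_conj_linear : forall a c (k : R[i]) b b',
    pi a (k *: b + b') c = k^* *: pi a b c + pi a b' c;
  jbt_symmetric : forall a b c, pi a b c = pi c b a;
  jbt_jordan : forall a b c d e,
    pi a b (pi c d e) =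
      pi (pi a b c) d e - pi c (pi b a d) e + pi c d (pi a b e) }.

(* Main.v *)
From HB Require Import structures.
Require Import Defs.
From mathcomp Require Import all_boot all_order all_algebra.
From mathcomp Require Import complex.
From mathcomp Require Import all_classical all_reals all_analysis.
From mathcomp Require Import ring.

(** The triple product is symmetric in its outer variables, so interchanging the
outer nets turns the iterated limits that define one extension into those that
define the extension of reversed order; this gives the three identities.

For the second part, a bounded linear or conjugate linear map from the space to
its bidual has an explicit weak-star continuous extension to the bidual
([extend]), and extending the three variables of a product in turn yields the
iterated limits ([arens_iterated_lim]). Write [J] for the embedding into the
bidual. If [pi^0] is symmetric in the outer variables then, for [x] in the
space,
  [pi^0(J x, n, p) = pi^0(p, n, J x) = lim_c lim_b pi(p_c, n_b, x)],
because in the last expression the limit in the third variable is an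
evaluation. By symmetry of the product the right-hand side is
[lim_c lim_b pi(x, n_b, p_c)], that is [pi^1(J x, n, p)] ([arens0_embed_r]).
The two extensions are obtained from these values by extending the first
variable, so they coincide ([aron_berner0_eq1]). The reversal identities then
transport the equality to [pi^2] and [pi^4].

The extensions are specified by quantifying over all approximating nets. Where
some argument has no such net, the specification is the same for every order of
limits ([wstar_extension_vacuous]), so the comparison of [pi^0] with [pi^1] is
immediate there. *)

Set Implicit Arguments.
Unset Strict Implicit.
Unset Printing Implicit Defensive.

Import Order.TTheory GRing.Theory Num.Theory.
Import numFieldNormedType.Exports.
Local Open Scope classical_set_scope.
Local Open Scope ring_scope.

(** * Conjugation switched by a boolean *)

Section Twist.
Variable R : realType.
Local Notation C := (R[i]^o).

(** One boolean per variable records whether a map is linear or conjugate linear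
in it, so that a single construction serves the outer and the middle variables
of a triple product. *)
Definition twist (s : bool) (z : R[i]) : R[i] := if s then z^* else z.

Lemma twistK s : involutive (twist s).
Proof. by case: s => // z; exact: conjCK. Qed.

Lemma twist1 s : twist s 1 = 1.
Proof. by case: s => //; exact: rmorph1. Qed.

Lemma twistD s : {morph twist s : x y / x + y}.
Proof. by case: s => // x y; rewrite /twist rmorphD. Qed.

Lemma twistB s : {morph twist s : x y / x - y}.
Proof. by case: s => // x y; rewrite /twist rmorphB. Qed.

Lemma twistM s : {morph twist s : x y / x * y}.
Proof. by case: s => // x y; rewrite /twist rmorphM. Qed.

Lemma norm_twist s z : `|twist s z| = `|z|.
Proof. by case: s => //; exact: norm_conjC. Qed.

Lemma twist_cvg s (I : Type) (F : set_system I) (g : I -> C) (l : C) :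
  Filter F -> g @ F --> l ->
  (fun a => twist s (g a) : C) @ F --> (twist s l : C).
Proof.
move=> FF /(cvgrPdist_lt (V := C)) gl; apply/(cvgrPdist_lt (V := C)) => e e0.
by apply: filterS (gl e e0) => a; rewrite -twistB norm_twist.
Qed.

End Twist.

(** * Weak-star limits along nets *)

Section Limits.
Variables (R : realType) (E : normedModType R[i]).
Local Notation C := (R[i]^o).

Lemma wstar_cvgP (I : Type) (F : set_system I) (g : I -> bidual E)
    (m : bidual E) : Filter F ->
  wstar_cvg F g m <-> forall f : dual E, (fun a => g a f : C) @ F --> (m f : C).
Proof. by move=> FF; rewrite /wstar_cvg pointwise_cvgP. Qed.

Lemma wstar_cvg_unique (I : Type) (F : set_system I) (g : I -> bidual E)
    (m m' : bidual E) : ProperFilter F ->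
  wstar_cvg F g m -> wstar_cvg F g m' -> m = m'.
Proof.
move=> FF /wstar_cvgP gm /wstar_cvgP gm'; apply/val_inj/funext => f.
exact: (norm_cvg_unique (gm f) (gm' f)).
Qed.

Global Instance net_tails_filter (T : Type) (u : net T) :
  ProperFilter (net_tails u).
Proof.
split; first by case=> a /(_ a (net_refl a)).
split.
- by have [a _] := net_inhabited u; exists a.
- move=> A B [a aA] [b bB]; have [c [ac bc]] := net_directed a b.
  by exists c => d cd; split; [apply: aA | apply: bB]; exact: net_trans cd.
- by move=> A B AB [a aA]; exists a => b /aA /AB.
Qed.

(** The inner limits are determined pair by pair, hence as functions; this fixes
the family whose limit comes next. *)
Lemma iterated_wstar_lim_unique (T : Type) (u v w : net T)
    (g : net_index u -> net_index v -> net_index w -> bidual E) q q' :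
  iterated_wstar_lim g q -> iterated_wstar_lim g q' -> q = q'.
Proof.
move=> [h2 [h1 [g2 h21 h1q]]] [k2 [k1 [g2' k21 k1q']]].
have hk2 a b : h2 a b = k2 a b by exact: wstar_cvg_unique (g2 a b) (g2' a b).
have hk1 a : h1 a = k1 a.
  by apply: wstar_cvg_unique (h21 a) _; rewrite (funext (hk2 a)).
by apply: wstar_cvg_unique h1q _; rewrite (funext hk1).
Qed.

Definition approximable (m : bidual E) := exists u : net E,
  bounded_net u /\ wstar_cvg (net_tails u) (@bidual_embed R E \o u) m.

Lemma approximable_embed (x : E) : approximable (bidual_embed x).
Proof.
pose u : net E := @Net E unit (fun _ _ => True) (fun _ => I)
  (fun _ _ _ _ _ => I) (fun _ _ => ex_intro _ tt (conj I I))
  (ex_intro _ tt I) (fun _ => x).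
exists u; split; first by exists `|x|.
by apply/wstar_cvgP => f; exact: (cvg_cst (bidual_embed x f : C)).
Qed.

Lemma wstar_extension_eq L (m n p q : bidual E) :
  approximable m -> approximable n -> approximable p ->
  (forall u v w : net E,
    wstar_cvg (net_tails u) (@bidual_embed R E \o u) m ->
    wstar_cvg (net_tails v) (@bidual_embed R E \o v) n ->
    wstar_cvg (net_tails w) (@bidual_embed R E \o w) p ->
    L u v w q) ->
  (forall u v w r r', L u v w r -> L u v w r' -> r = r') ->
  wstar_extension L m n p = q.
Proof.
move=> [u [bu um]] [v [bv vn]] [w [bw wp]] Lq L1; apply: xget_unique.
  by move=> u' v' w' _ _ _; exact: Lq.
by move=> r Lr; apply: (L1 u v w); [exact: Lr | exact: Lq].
Qed.

(** Without approximating nets the condition that characterises the extension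
holds of every element of the bidual, whatever the order of the limits; two
orders then select the same element. This replaces an appeal to Goldstine's
theorem. *)
Lemma wstar_extension_vacuous L L' (m n p : bidual E) :
  ~ [/\ approximable m, approximable n & approximable p] ->
  wstar_extension L m n p = wstar_extension L' m n p.
Proof.
move=> nap; congr xget; apply/seteqP; split=> q _ u v w bu bv bw um vn wp;
  by case: nap; split; [exists u | exists v | exists w].
Qed.

End Limits.

(** * Extending one variable to the bidual *)

Section Extension.
Variables (R : realType) (E : normedModType R[i]).
Local Notation C := (R[i]^o).
Local Notation J := (@bidual_embed R E).

Definition bounded_twisted (V : normedModType R[i]) (s : bool) (Phi : E -> V)
    (M : R[i]) :=
  [/\ forall k x y, Phi (k *: x + y) = twist s k *: Phi x + Phi y,
      0 <= M & forall x, `|Phi x| <= M * `|x|].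

Lemma dual_predI (V : normedModType R[i]) (g : V -> C) (M : R[i]) :
  linear g -> (forall x, `|g x| <= M * `|x|) -> 0 <= M -> g \in @dual_pred R V.
Proof.
move=> lg gM M0; apply/asboolP; split=> //.
pose h : {linear V -> C} :=
  HB.pack g (GRing.isLinear.Build _ _ _ _ _ lg).
apply: (@bounded_linear_continuous _ _ _ h); apply/bounded_funP => r.
exists (M * r) => x xr.
by apply: le_trans (gM x) _; rewrite ler_wpM2l.
Qed.

Lemma dualE (V : normedModType R[i]) (f g : dual V) k x :
  (k *: f + g) x = k * f x + g x.
Proof. by []. Qed.

Lemma dual_ext (V : normedModType R[i]) (f g : dual V) :
  (forall x, f x = g x) -> f = g.
Proof. by move=> fg; apply/val_inj/funext. Qed.

(** The twist makes [x |-> Phi x f] linear even when [Phi] is conjugate linear,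
so that an element of the bidual can be evaluated at it. The default value [0]
of [insubd] does not arise when [Phi] satisfies [bounded_twisted]. *)
Definition slice s (Phi : E -> bidual E) (f : dual E) : dual E :=
  locked (insubd 0 (fun x => twist s (Phi x f) : C)).

(** The weak-star continuous extension of [Phi] to the bidual: [m] is applied to
the slice, and the second twist restores the original kind of linearity. *)
Definition extend s (Phi : E -> bidual E) (m : bidual E) : bidual E :=
  locked (insubd 0 (fun f => twist s (m (slice s Phi f)) : C)).

Section OneVariable.
Variables (s : bool) (Phi : E -> bidual E) (M : R[i]).
Hypothesis bPhi : bounded_twisted s Phi M.

Lemma sliceE f x : slice s Phi f x = twist s (Phi x f).
Proof.
have [lPhi M0 nPhi] := bPhi.
rewrite -[LHS]/(val (slice s Phi f) x) /slice -lock val_insubd ifT//.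
apply: (@dual_predI _ _ (M * `|f|)) => [k y z|y|]; last exact: mulr_ge0.
  rewrite lPhi -[_ f]/(twist s k * Phi y f + Phi z f) twistD twistM twistK.
  by [].
rewrite norm_twist mulrAC.
apply: le_trans (dual_normP _ _) _.
by apply: ler_wpM2r; [exact: dual_norm_ge0 | exact: nPhi].
Qed.

Lemma norm_slice f : `|slice s Phi f| <= M * `|f|.
Proof.
have [lPhi M0 nPhi] := bPhi.
apply: dual_norm_le => x x1; rewrite sliceE norm_twist.
apply: le_trans (dual_normP _ _) _; rewrite ler_wpM2r//.
by apply: le_trans (nPhi x) _; exact: ler_piMr.
Qed.

Lemma slice_linear k f g : slice s Phi (k *: f + g) =
  twist s k *: slice s Phi f + slice s Phi g.
Proof.
apply: dual_ext => x.
apply: etrans (sliceE _ _) _.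
apply: etrans (congr1 (twist s) (dual_linear (Phi x) k f g)) _.
apply: etrans (twistD _ _ _) _.
apply: esym; apply: etrans (dualE _ _ _ _) _.
congr (_ + _); last exact: sliceE.
exact: etrans (congr1 _ (sliceE f x)) (esym (twistM _ _ _)).
Qed.

Lemma extendE m f : extend s Phi m f = twist s (m (slice s Phi f)).
Proof.
have [_ M0 _] := bPhi.
rewrite -[LHS]/(val (extend s Phi m) f) /extend -lock val_insubd ifT//.
apply: (@dual_predI _ _ (`|m| * M)) => [k g h|g|]; last exact: mulr_ge0.
  rewrite slice_linear dual_linear twistD.
  rewrite -[twist s (_ *: _)]/(twist s (_ * _)) twistM twistK.
  by [].
rewrite norm_twist -mulrA.
apply: le_trans (dual_normP _ _) _.
by apply: ler_wpM2l (norm_slice g); exact: dual_norm_ge0.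
Qed.

Lemma norm_extend m : `|extend s Phi m| <= M * `|m|.
Proof.
have [_ M0 _] := bPhi.
apply: dual_norm_le => f f1; rewrite extendE norm_twist mulrC.
apply: le_trans (dual_normP _ _) _.
apply: ler_wpM2l; first exact: dual_norm_ge0.
by apply: le_trans (norm_slice f) _; exact: ler_piMr.
Qed.

Lemma extend_embed x : extend s Phi (J x) = Phi x.
Proof.
apply: dual_ext => f.
by rewrite extendE/= /eval_at sliceE twistK.
Qed.

(** Evaluated at [f], the net [Phi \o u] is the twist of [J \o u] evaluated at
the single functional [slice s Phi f], and the twist is continuous. *)
Lemma extend_cvg (u : net E) m : wstar_cvg (net_tails u) (J \o u) m ->
  wstar_cvg (net_tails u) (Phi \o u) (extend s Phi m).
Proof.
move=> /wstar_cvgP um; apply/wstar_cvgP => f; rewrite extendE.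
have -> : (fun a => (Phi \o u) a f : C) =
    fun a => twist s ((J \o u) a (slice s Phi f)).
  by apply/funext => a /=; rewrite /eval_at sliceE twistK.
exact: twist_cvg (um _).
Qed.

End OneVariable.

(** Linearity in the extended map itself: needed when [Phi] depends on a further
variable, which is to be extended afterwards. Both twists act on [k], so the
scalar comes out unconjugated for either value of [s]. *)
Lemma extend_linear s (Phi Psi : E -> bidual E) (M N : R[i]) k m :
  bounded_twisted s Phi M -> bounded_twisted s Psi N ->
  extend s (fun x => k *: Phi x + Psi x) m =
  k *: extend s Phi m + extend s Psi m.
Proof.
move=> bPhi bPsi.
have b : bounded_twisted s (fun x => k *: Phi x + Psi x) (`|k| * M + N).
  have [lPhi M0 nPhi] := bPhi; have [lPsi N0 nPsi] := bPsi.
  split=> [c x y||x]; last 2 first.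
  - by rewrite addr_ge0// mulr_ge0.
  - rewrite mulrDl; apply: le_trans (ler_normD _ _) _; apply: lerD => //.
    by rewrite normrZ -mulrA ler_wpM2l.
  by rewrite lPhi lPsi !scalerDr !scalerA [k * _]mulrC addrACA.
apply: dual_ext => f.
have slice_combination : slice s (fun x => k *: Phi x + Psi x) f =
    twist s k *: slice s Phi f + slice s Psi f.
  apply: dual_ext => x; apply: etrans (sliceE b f x) _.
  apply: etrans (congr1 (twist s) (dualE (Phi x) (Psi x) k f)) _.
  apply: etrans (twistD _ _ _) _; apply: esym; apply: etrans (dualE _ _ _ _) _.
  congr (_ + _); last exact: sliceE bPsi f x.
  exact: etrans (congr1 _ (sliceE bPhi f x)) (esym (twistM _ _ _)).
apply: etrans (extendE b m f) _; rewrite slice_combination dual_linear.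
apply: etrans (twistD _ _ _) _; apply: esym; apply: etrans (dualE _ _ _ _) _.
congr (_ + _); last exact: extendE bPsi m f.
apply: etrans (congr1 _ (extendE bPhi m f)) _.
by rewrite -[twist s (_ *: _)]/(twist s (_ * _)) twistM twistK.
Qed.

(** * Extending three variables in turn *)

(** The bound is required uniformly in the three variables: it bounds each
successive extension as a function of the variables not extended yet. *)
Record trilinear_twisted (s1 s2 s3 : bool) (T : E -> E -> E -> E) (K : R[i]) :=
  TrilinearTwisted {
  tt1 : forall y z k x x',
    T (k *: x + x') y z = twist s1 k *: T x y z + T x' y z;
  tt2 : forall x z k y y',
    T x (k *: y + y') z = twist s2 k *: T x y z + T x y' z;
  tt3 : forall x y k z z',
    T x y (k *: z + z') = twist s3 k *: T x y z + T x y z';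
  tt_ge0 : 0 <= K;
  tt_bound : forall x y z, `|T x y z| <= K * `|x| * `|y| * `|z| }.

(** The last variable is extended first, matching the order of the limits. *)
Definition arens3 s3 (T : E -> E -> E -> E) x y p :=
  extend s3 (fun z => J (T x y z)) p.
Definition arens2 s2 s3 (T : E -> E -> E -> E) x n p :=
  extend s2 (fun y => arens3 s3 T x y p) n.
Definition arens s1 s2 s3 (T : E -> E -> E -> E) m n p :=
  extend s1 (fun x => arens2 s2 s3 T x n p) m.

Lemma embed_linear k (x y : E) : J (k *: x + y) = k *: J x + J y.
Proof.
apply: dual_ext => f.
by rewrite [RHS]dualE /= /eval_at dual_linear.
Qed.

Lemma norm_embed x : `|J x| <= `|x|.
Proof.
apply: dual_norm_le => f f1; rewrite -[leLHS]/(`|f x|).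
by apply: le_trans (dual_normP _ _) _; exact: ler_piMl.
Qed.

Section Arens.
Variables (s1 s2 s3 : bool) (T : E -> E -> E -> E) (K : R[i]).
Hypothesis hT : trilinear_twisted s1 s2 s3 T K.

Lemma arens3_bounded x y :
  bounded_twisted s3 (fun z => J (T x y z)) (K * `|x| * `|y|).
Proof.
have K0 := tt_ge0 hT.
split=> [k z z'||z]; first by rewrite (tt3 hT) embed_linear.
  by rewrite !mulr_ge0.
by apply: le_trans (norm_embed _) _; exact: (tt_bound hT).
Qed.

Lemma arens2_bounded x p :
  bounded_twisted s2 (fun y => arens3 s3 T x y p) (K * `|x| * `|p|).
Proof.
have K0 := tt_ge0 hT.
split=> [k y y'||y]; last 2 first.
- by rewrite !mulr_ge0.
- rewrite mulrAC; exact: (norm_extend (arens3_bounded x y)).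
rewrite /arens3.
rewrite -(extend_linear _ _ (arens3_bounded x y) (arens3_bounded x y')).
by apply: (congr1 (extend s3 ^~ p)); apply/funext => z; rewrite (tt2 hT) embed_linear.
Qed.

Lemma arens1_bounded n p :
  bounded_twisted s1 (fun x => arens2 s2 s3 T x n p) (K * `|n| * `|p|).
Proof.
have K0 := tt_ge0 hT.
split=> [k x x'||x]; last 2 first.
- by rewrite !mulr_ge0.
- rewrite mulrAC [X in X * _]mulrAC [leRHS]mulrAC.
  exact: (norm_extend (arens2_bounded x p)).
rewrite /arens2.
rewrite -(extend_linear _ _ (arens2_bounded x p) (arens2_bounded x' p)).
apply: (congr1 (extend s2 ^~ n)); apply/funext => y; rewrite /arens3.
rewrite -(extend_linear _ _ (arens3_bounded x y) (arens3_bounded x' y)).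
by apply: (congr1 (extend s3 ^~ p)); apply/funext => z; rewrite (tt1 hT) embed_linear.
Qed.

(** Each layer of extensions supplies one layer of limits; this also gives the
existence of the inner limits in the bidual. *)
Lemma arens_iterated_lim (u v w : net E) m n p :
  wstar_cvg (net_tails u) (J \o u) m ->
  wstar_cvg (net_tails v) (J \o v) n ->
  wstar_cvg (net_tails w) (J \o w) p ->
  iterated_wstar_lim (u := u) (v := v) (w := w)
    (fun a b c => J (T (u a) (v b) (w c))) (arens s1 s2 s3 T m n p).
Proof.
move=> um vn wp.
exists (fun a b => arens3 s3 T (u a) (v b) p),
  (fun a => arens2 s2 s3 T (u a) n p).
split=> [a b|a|].
- exact: (extend_cvg (arens3_bounded (u a) (v b)) wp).
- exact: (extend_cvg (arens2_bounded (u a) p) vn).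
- exact: (extend_cvg (arens1_bounded n p) um).
Qed.

End Arens.

Lemma twisted0 (V : normedModType R[i]) s (g : E -> V) :
  (forall k x y, g (k *: x + y) = twist s k *: g x + g y) -> g 0 = 0.
Proof.
(* The instance g (1 *: 0 + 0) reads g 0 = g 0 + g 0. *)
move=> /(_ 1 0 0); rewrite scale1r addr0 twist1 scale1r.
by move=> /esym/eqP; rewrite addrC -subr_eq0 addrK => /eqP.
Qed.

(** Homogeneity: a nonzero [x] is rescaled to norm [e / 2], inside the ball where
the bound [c] is known. The rescaling factor is positive, and twisting preserves
its norm. *)
Lemma twisted_bound_of_ball (V : normedModType R[i]) s (g : E -> V) (e c : R[i]) :
  (forall k x y, g (k *: x + y) = twist s k *: g x + g y) ->
  0 < e -> (forall x, `|x| < e -> `|g x| <= c) ->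
  forall x, `|g x| <= c * (2 / e) * `|x|.
Proof.
move=> lg e0 gc x.
have g0 := twisted0 lg.
have [->|x0] := eqVneq x 0; first by rewrite g0 !normr0 mulr0.
pose t := e / 2 / `|x|.
have t0 : 0 < t by rewrite !divr_gt0// normr_gt0.
have tx : `|t *: x| < e.
  rewrite normrZ gtr0_norm// divfK ?normr_eq0//.
  by rewrite ltr_pdivrMr// mulr_natr mulr2n ltrDl.
have := gc _ tx; rewrite -[t *: x]addr0 lg g0 addr0 normrZ norm_twist gtr0_norm//.
rewrite -ler_pdivlMl// => /le_trans; apply.
by rewrite le_eqVlt /t !invfM !invrK; apply/orP; left; apply/eqP; ring.
Qed.

End Extension.

(** * The two extensions of a triple product *)

Section Triple.
Variables (R : realType) (E : completeNormedModType R[i]).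
Variable pi : E -> E -> E -> E.
Hypothesis hpi : jordan_banach_triple pi.
Local Notation J := (@bidual_embed R E).

(** Continuity at the origin gives the bound [1] on a product of balls; the three
variables are then released from their balls one at a time. *)
Lemma triple_bound : exists2 K : R[i], 0 <= K &
  forall x y z, `|pi x y z| <= K * `|x| * `|y| * `|z|.
Proof.
have pi0 : pi 0 0 0 = 0 := twisted0 (s := false) (jbt_linear_r hpi 0 0).
have cpi : {for (0 : E * E * E), continuous (fun x => pi x.1.1 x.1.2 x.2)}.
  exact: jbt_continuous.
have /cvgrPdist_lt/(_ 1 ltr01) := cpi.
rewrite /= pi0 => /nbhs_ballP[e /= e0 be].
have b1 x y z : `|x| < e -> `|y| < e -> `|z| < e -> `|pi x y z| <= 1.
  move=> xe ye ze; have := be (x, y, z); rewrite /= sub0r normrN => h; apply/ltW/h.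
  by split; [split|]; rewrite /= -ball_normE /= sub0r normrN.
exists (2 / e * (2 / e) * (2 / e)).
  by rewrite !mulr_ge0// ?invr_ge0 ltW.
move=> x y z.
have b3 x' y' z' : `|x'| < e -> `|y'| < e -> `|pi x' y' z'| <= 2 / e * `|z'|.
  move=> x'e y'e; have := twisted_bound_of_ball (s := false)
    (jbt_linear_r hpi x' y') e0 (fun z => b1 x' y' z x'e y'e) z'.
  by rewrite mul1r.
have b2 x' y' z' : `|x'| < e ->
    `|pi x' y' z'| <= 2 / e * `|z'| * (2 / e) * `|y'|.
  move=> x'e.
  apply: (twisted_bound_of_ball (s := true) (g := fun y => pi x' y z')) => //.
    by move=> k a b; rewrite (jbt_conj_linear hpi).
  by move=> y''; exact: b3.
have -> : 2 / e * (2 / e) * (2 / e) * `|x| * `|y| * `|z| =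
    2 / e * `|z| * (2 / e) * `|y| * (2 / e) * `|x| by ring.
apply: (twisted_bound_of_ball (s := false) (jbt_linear_l hpi y z)) => //.
by move=> x'; exact: b2.
Qed.

Lemma trilinear_twisted_triple :
  exists K, trilinear_twisted false true false pi K.
Proof.
have [K K0 piK] := triple_bound; exists K; split => //.
- by move=> y z k x x'; exact: jbt_linear_l.
- by move=> x z k y y'; exact: jbt_conj_linear.
- by move=> x y k z z'; exact: jbt_linear_r.
Qed.

Lemma trilinear_twisted_swap :
  exists K, trilinear_twisted false false true (fun x z y => pi x y z) K.
Proof.
have [K [h1 h2 h3 K0 piK]] := trilinear_twisted_triple.
exists K; split => // x z y; rewrite mulrAC; exact: piK.
Qed.

Lemma aron_berner0_arens (m n p : bidual E) :
  approximable m -> approximable n -> approximable p ->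
  aron_berner0 pi m n p = arens false true false pi m n p.
Proof.
move=> am an ap; have [K hK] := trilinear_twisted_triple.
apply: wstar_extension_eq => // [u v w um vn wp|u v w q q'].
  exact: (arens_iterated_lim hK um vn wp).
exact: iterated_wstar_lim_unique.
Qed.

Lemma aron_berner1_arens (m n p : bidual E) :
  approximable m -> approximable n -> approximable p ->
  aron_berner1 pi m n p = arens false false true (fun x z y => pi x y z) m p n.
Proof.
move=> am an ap; have [K hK] := trilinear_twisted_swap.
apply: wstar_extension_eq => // [u v w um vn wp|u v w q q'].
  exact: (arens_iterated_lim hK um wp vn).
exact: iterated_wstar_lim_unique.
Qed.

(** With an element [x] of the space in the third place, the innermost extension
is evaluation, and symmetry of the triple product turns what remains into the
two inner layers of the other order of limits. *)
Lemma arens0_embed_r x (n p : bidual E) :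
  arens false true false pi p n (J x) =
  arens2 false true (fun x z y => pi x y z) x p n.
Proof.
have [K hK] := trilinear_twisted_triple.
apply: (congr1 (extend false ^~ p)); apply/funext => z.
apply: (congr1 (extend true ^~ n)); apply/funext => y.
apply: etrans (extend_embed (arens3_bounded hK z y) x) _.
by rewrite (jbt_symmetric hpi).
Qed.

Lemma arens0_embed_l x (n p : bidual E) :
  arens false true false pi (J x) n p = arens2 true false pi x n p.
Proof.
have [K hK] := trilinear_twisted_triple.
exact: (extend_embed (arens1_bounded hK n p) x).
Qed.

(** Symmetry is used with an element of the space in one outer place; it
identifies the inner layers of the two orders, hence, extending the first
variable, the whole extensions. *)
Lemma aron_berner0_eq1 :
  (forall m n p : bidual E,
     aron_berner0 pi m n p = aron_berner0 pi p n m) ->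
  aron_berner0 pi = aron_berner1 pi.
Proof.
move=> sym; apply/funext => m; apply/funext => n; apply/funext => p.
have [[am an ap]|nap] :=
  pselect [/\ approximable m, approximable n & approximable p]; last first.
  exact: wstar_extension_vacuous.
apply: etrans (aron_berner0_arens am an ap) _.
apply: esym; apply: etrans (aron_berner1_arens am an ap) _.
apply: (congr1 (extend false ^~ m)); apply/funext => x.
have ax := approximable_embed x.
apply: etrans (esym (arens0_embed_r x n p)) _.
apply: etrans (esym (aron_berner0_arens ap an ax)) _.
apply: etrans (sym p n (J x)) _.
apply: etrans (aron_berner0_arens ax an ap) _.
exact: arens0_embed_l.
Qed.

(** Reversing the product reverses the roles of the outer nets and leaves each
approximating triple product unchanged. *)
Lemma aron_berner_reverse (m n p : bidual E) :
  [/\ aron_berner0 pi m n p = aron_berner2 pi p n m,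
      aron_berner1 pi m n p = aron_berner4 pi p n m
    & aron_berner3 pi m n p = aron_berner5 pi p n m].
Proof.
have sym : pi = fun a b c => pi c b a.
  apply/funext => a; apply/funext => b; apply/funext => c.
  exact: jbt_symmetric.
split; congr xget; apply/seteqP; split=> q hq u v w bu bv bw um vn wp;
  have := hq w v u bw bv bu wp vn um; rewrite /= [in X in X -> _]sym; exact.
Qed.

End Triple.

(** * Comparison of the six extensions *)

Theorem proposition3p6 (R : realType) (E : completeNormedModType R[i])
    (pi : E -> E -> E -> E) (hpi : jordan_banach_triple pi) :
  (forall m n p : bidual E,
    [/\ aron_berner0 pi m n p = aron_berner2 pi p n m,
        aron_berner1 pi m n p = aron_berner4 pi p n m
      & aron_berner3 pi m n p = aron_berner5 pi p n m]) /\
  ((forall m n p : bidual E,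
      aron_berner0 pi m n p = aron_berner0 pi p n m) ->
    [/\ aron_berner0 pi = aron_berner1 pi,
        aron_berner1 pi = aron_berner2 pi
      & aron_berner2 pi = aron_berner4 pi]).
Proof.
have rev := aron_berner_reverse hpi.
split=> // sym.
have eq01 := aron_berner0_eq1 hpi sym.
have eq02 : aron_berner0 pi = aron_berner2 pi.
  apply/funext => m; apply/funext => n; apply/funext => p.
  by rewrite sym; have [] := rev p n m.
have eq04 : aron_berner0 pi = aron_berner4 pi.
  apply/funext => m; apply/funext => n; apply/funext => p.
  by rewrite sym eq01; have [] := rev p n m.
by split; rewrite -?eq01 -?eq02 -?eq04.
Qed.
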